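(* For $p\ge 1$ and $a\in(-1/p,\infty)$ let $X^{(p)}(a)=I_p+aE_{p\times p}$, where $E_{p\times p}$ is the $p\times p$ matrix with all entries equal to $1$. For every fixed $\alpha\in(0,1)$, the PoSI constants $K(X^{(p)}(a),\alpha)$ satisfy $$\lim_{p\to\infty}\ \sup_{a\in(-1/p,\infty)}\ \frac{K(X^{(p)}(a),\alpha)}{\sqrt{2\log p}}=2 .$$
   Context: PoSI constant for known variance ($\sigma=1$, $r=\infty$) and all submodels. Let $X=(X_1,\dots,X_p)$ be a nonsingular real $p\times p$ matrix. For nonempty $M\subset\{1,\dots,p\}$ and $j\in M$, $X_{j\cdot M}\in\mathbb R^p$ is the residual vector of $X_j$ after orthogonal projection onto the span of $\{X_k:k\in M\setminus\{j\}\}$ (equal to $X_j$ if $M=\{j\}$), and $\bar l_{j\cdot M}=X_{j\cdot M}/\|X_{j\cdot M}\|$. With $Z\sim N(0,I_p)$, $K(X,\alpha)$ is the minimal $K$ such that $$P\Bigl[\max_{\varnothing\neq M\subset\{1,\dots,p\}}\max_{j\in M}|\bar l_{j\cdot M}^TZ|\le K\Bigr]\ge1-\alpha .$$ *)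

(* Defs.v *)
From HB Require Import structures.
From mathcomp Require Import all_boot all_order all_algebra.
From mathcomp Require Import sesquilinear.
From mathcomp Require Import all_classical all_reals all_analysis.

Set Implicit Arguments.
Unset Strict Implicit.
Unset Printing Implicit Defensive.

Import Order.TTheory GRing.Theory Num.Theory.
Import numFieldNormedType.Exports.

Local Open Scope classical_set_scope.
Local Open Scope ring_scope.

(* Vectors of R^p are row vectors, to match the row-space conventions of
   mxalgebra; the column X_j of X is therefore (col j X)^T. *)

Definition dotv (R : realType) (p : nat) (u v : 'rV[R]_p) : R :=
  (u *m v^T) 0 0.

(* The norm `|u| that the library puts on matrices is the sup norm. *)
Definition l2norm (R : realType) (p : nat) (u : 'rV[R]_p) : R :=
  Num.sqrt (dotv u u).

(* The right action of [orthoproj S] is the Euclidean orthogonal projection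
   onto the row space of S: the projection onto S parallel to its orthogonal
   complement (same construction as [proj_ortho], which is only available over
   a numClosedFieldType). *)
Definition orthoproj (R : realType) (m p : nat) (S : 'M[R]_(m, p)) : 'M[R]_p :=
  proj_mx <<S>>%MS (orthomx idfun 1%:M S).

Definition colspan (R : realType) (p : nat) (X : 'M[R]_p) (A : {set 'I_p}) :
    'M[R]_p :=
  (\sum_(k in A) <<(col k X)^T>>)%MS.

(* X_{j.M} *)
Definition residual (R : realType) (p : nat) (X : 'M[R]_p) (M : {set 'I_p})
    (j : 'I_p) : 'rV[R]_p :=
  (col j X)^T - (col j X)^T *m orthoproj (colspan X (M :\ j)).

(* \bar l_{j.M} *)
Definition unit_residual (R : realType) (p : nat) (X : 'M[R]_p)
    (M : {set 'I_p}) (j : 'I_p) : 'rV[R]_p :=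
  (l2norm (residual X M j))^-1 *: residual X M j.

(* All the terms are nonnegative, so the default value 0 of the iterated
   maximum is harmless. *)
Definition posi_stat (R : realType) (p : nat) (X : 'M[R]_p) (z : 'rV[R]_p) : R :=
  \big[Num.max/0]_(M : {set 'I_p} | M != finset.set0)
    \big[Num.max/0]_(j in M) `|dotv (unit_residual X M j) z|.

Definition mutually_independent (d : measure_display) (T : measurableType d)
    (R : realType) (P : probability T R) (p : nat) (Z : 'I_p -> {RV P >-> R}) :
    Prop :=
  forall B : 'I_p -> set R, (forall i, measurable (B i)) ->
    P (\bigcap_(i in [set: 'I_p]) (Z i @^-1` B i)) =
      (\prod_(i < p) P (Z i @^-1` B i))%E.

(* The random vector with coordinates Z i has law N(0, I_p). *)
Definition std_gaussian (d : measure_display) (T : measurableType d)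
    (R : realType) (P : probability T R) (p : nat) (Z : 'I_p -> {RV P >-> R}) :
    Prop :=
  mutually_independent Z /\
  forall (i : 'I_p) (B : set R), measurable B ->
    distribution P (Z i) B = normal_prob 0 1 B.

(* K(X, alpha), for Z a realisation of N(0, I_p); it depends on Z only through
   its law. For 0 < alpha < 1 the infimum is a minimum, since a distribution
   function is right-continuous. *)
Definition posi_constant (d : measure_display) (T : measurableType d)
    (R : realType) (P : probability T R) (p : nat) (Z : 'I_p -> {RV P >-> R})
    (X : 'M[R]_p) (alpha : R) : R :=
  inf [set K : R |
    ((1 - alpha)%:E <= P [set w | (posi_stat X (\row_i Z i w) <= K)%R])%E].

Definition exchangeable_design (R : realType) (p : nat) (a : R) : 'M[R]_p :=
  1%:M + a *: const_mx 1.

(* Main.v *)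
Require Import Defs.
From HB Require Import structures.
From mathcomp Require Import all_boot all_order all_algebra.
From mathcomp Require Import all_classical all_reals all_analysis.
From mathcomp Require Import measurable_realfun sesquilinear ring lra.
Set Implicit Arguments.
Unset Strict Implicit.
Unset Printing Implicit Defensive.
Import Order.TTheory GRing.Theory Num.Theory.
Import numFieldNormedType.Exports.
Local Open Scope classical_set_scope.
Local Open Scope ring_scope.

(** Write [B = 2a + p a^2], so that the Gram matrix of the columns of
    [I + a E] is [I + B E], and [B > -1/p].  Everything rests on an explicit
    formula for the contrasts ([dotv_unit_residual]): for a model [M] of size
    [m] containing [j],

      l_{j.M}^T z = ((1 + m B) z_j - B sum_{k in M} z_k + a sum_k z_k)
                    / sqrt ((1 + m B) (1 + (m - 1) B)).

    Upper bound.  Whatever [a > -1/p], [M] and [j] are, this is at most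
    [2 max_k |z_k| + |sum_k z_k| / sqrt p] in absolute value ([posi_stat_le]).
    Once a multiple of the overall sum has been set apart, the weight of [z_j]
    and the total weight of the other coordinates (those of [M] if [a >= 0],
    those outside [M] if [a < 0]) are both at most the denominator, whence the
    factor 2.  The overall sum cannot be absorbed in [max_k |z_k|]: for the full
    model and [a] close to [-1/p] the contrast is close to
    [sum_k z_k / sqrt p].  With probability close to one, [max_k |Z_k|] is at
    most [(1 + e) sqrt (2 ln p)] by the union bound and the Gaussian tail
    ([std_normal_ray_le]), and [|sum_k Z_k| / sqrt p], whose second moment is
    bounded, is at most [e sqrt (2 ln p)] ([gaussian_sum_tail]).

    Lower bound.  Take [a = 1], fix a large [m], and cut the indices into [m]
    blocks of [p %/ m] indices.  In each block some coordinate exceeds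
    [(1 - e) sqrt (2 ln p)], and some coordinate is below the opposite of this
    value, with probability close to one ([block_miss_probability]).  A model
    [M] made of one very large positive coordinate [j] and of [m - 1] very large
    negative ones, one per block, gives a contrast of at least about
    [2 (m - 1) / (m + 1)] times [(1 - e) sqrt (2 ln p)] ([posi_stat_ge]), and
    [(m - 1) / (m + 1)] is as close to one as desired.

    Both bounds hold on events whose probability tends to one, which is why the
    limit does not depend on [alpha]. *)

(** * Residuals of the exchangeable design *)

Lemma dotvE (R : realType) (p : nat) (u v : 'rV[R]_p) :
  dotv u v = \sum_i u 0 i * v 0 i.
Proof. by rewrite /dotv mxE; apply: eq_bigr => i _; rewrite mxE. Qed.

Lemma dotvv_eq0 (R : realType) (p : nat) (u : 'rV[R]_p) : dotv u u = 0 -> u = 0.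
Proof.
rewrite dotvE => /eqP; rewrite psumr_eq0; last by move=> i _; rewrite -expr2 sqr_ge0.
move=> /allP u0; apply/rowP => i; rewrite mxE; apply/eqP.
by have := u0 i (mem_index_enum i); rewrite /= mulf_eq0 orbb.
Qed.

(** A row space meets its orthogonal complement trivially over the reals, so
    any decomposition into an element of [S] and a vector orthogonal to [S] is
    the one computed by the projection.  It then suffices to guess the
    residual and to check two linear conditions. *)
Lemma orthoproj_decomp (R : realType) (m p : nat) (S : 'M[R]_(m, p))
    (w r : 'rV[R]_p) :
  (w <= S)%MS -> r *m S^T = 0 -> (w + r) *m orthoproj S = w.
Proof.
move=> wS rS; have orthP (v : 'rV[R]_p) :
    (v <= orthomx idfun 1%:M S)%MS = (v *m S^T == 0).
  apply/sub_kermxP/eqP; rewrite mul1mx => h.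
    by rewrite -[RHS]h; congr (_ *m _); apply/matrixP => i j; rewrite !mxE.
  by rewrite -[RHS]h; congr (_ *m _); apply/matrixP => i j; rewrite !mxE.
have dx : (<<S>> :&: orthomx idfun 1%:M S = 0)%MS.
  apply/eqP; rewrite -submx0; apply/rV_subP => v.
  rewrite sub_capmx genmxE orthP => /andP[/submxP[D vD] /eqP vS].
  rewrite submx0; apply/eqP/dotvv_eq0.
  by rewrite /dotv [in v^T]vD trmx_mul mulmxA vS mul0mx mxE.
rewrite mulmxDl (proj_mx_id dx) ?genmxE// (proj_mx_0 dx) ?addr0//.
by rewrite orthP rS.
Qed.

Lemma dotvZl (R : realType) (p : nat) (c : R) (u v : 'rV[R]_p) :
  dotv (c *: u) v = c * dotv u v.
Proof. by rewrite /dotv -scalemxAl mxE. Qed.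

Lemma dotvC (R : realType) (p : nat) (u v : 'rV[R]_p) : dotv u v = dotv v u.
Proof. by rewrite !dotvE; apply: eq_bigr => i _; rewrite mulrC. Qed.

Lemma colspan_ortho (R : realType) (p : nat) (X : 'M[R]_p) (A : {set 'I_p})
    (r : 'rV[R]_p) : (forall k, k \in A -> dotv r (col k X)^T = 0) ->
  r *m (colspan X A)^T = 0.
Proof.
move=> rX; have : (colspan X A <= kermx r^T)%MS.
  apply/sumsmx_subP => k kA; rewrite genmxE; apply/sub_kermxP.
  apply/matrixP => i j; rewrite !ord1 [RHS]mxE.
  by have := rX k kA; rewrite dotvC.
by move=> /sub_kermxP XrT; apply: trmx_inj; rewrite trmx_mul trmxK XrT trmx0.
Qed.

(** The coefficient [B] for which the Gram matrix of the columns of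
    [I + a E] is [I + B E]. *)
Definition gram_excess (R : realType) (p : nat) (a : R) : R :=
  2 * a + p%:R * a ^+ 2.

(** The residual X_{j.M} multiplied by [1 + (#|M| - 1) B], which clears its
    denominators and makes its entries affine in the two indicators. *)
Definition scaled_residual (R : realType) (p : nat) (a : R) (M : {set 'I_p})
    (j : 'I_p) : 'rV[R]_p :=
  \row_i ((1 + #|M|%:R * gram_excess p a) * (i == j)%:R
          - gram_excess p a * (i \in M)%:R + a).

Lemma scaled_residualE (R : realType) (p : nat) (a : R) (M : {set 'I_p})
    (i j : 'I_p) :
  scaled_residual a M j 0 i =
  (1 + #|M|%:R * gram_excess p a) * (i == j)%:R
  - gram_excess p a * (i \in M)%:R + a.
Proof. by rewrite mxE. Qed.

Lemma dotv_scaled_residual (R : realType) (p : nat) (a : R) (M : {set 'I_p})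
    (j : 'I_p) (z : 'rV[R]_p) :
  let B := gram_excess p a in
  dotv (scaled_residual a M j) z =
  (1 + #|M|%:R * B) * z 0 j - B * (\sum_(i in M) z 0 i) + a * \sum_i z 0 i.
Proof.
rewrite /= dotvE; under [LHS]eq_bigr do rewrite scaled_residualE mulrDl mulrBl -!mulrA.
rewrite big_split sumrB/= -!mulr_sumr; congr (_ * _ - _ * _ + _).
  by rewrite (bigD1 j)//= eqxx mul1r big1 ?addr0// => i /negbTE ->; rewrite mul0r.
by rewrite [RHS]big_mkcond/=; apply: eq_bigr => i _; case: ifP; rewrite (mul1r,mul0r).
Qed.

Lemma col_exchangeable_design (R : realType) (p : nat) (a : R) (k i : 'I_p) :
  (col k (exchangeable_design p a))^T 0 i = (i == k)%:R + a.
Proof. by rewrite !mxE mulr1. Qed.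

Lemma sum_mem_all (R : realType) (p : nat) (M : {set 'I_p}) :
  \sum_(i < p) (i \in M)%:R = #|M|%:R :> R.
Proof.
rewrite -sum1_card natr_sum [RHS]big_mkcond/=.
by apply: eq_bigr => i _; case: (i \in M).
Qed.

Lemma sum_in_const (R : realType) (p : nat) (M : {set 'I_p}) (c : R) :
  \sum_(i in M) c = #|M|%:R * c.
Proof. by rewrite sumr_const mulr_natl. Qed.

Lemma sum_all_const (R : realType) (p : nat) (c : R) :
  \sum_(i < p) c = p%:R * c.
Proof. by rewrite sumr_const card_ord mulr_natl. Qed.

Lemma sum_in_delta (R : realType) (p : nat) (M : {set 'I_p}) (k : 'I_p) :
  \sum_(i in M) (i == k)%:R = (k \in M)%:R :> R.
Proof.
rewrite big_mkcond (bigD1 k)//= eqxx big1 ?addr0; first by case: (k \in M).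
by move=> i /negbTE ->; rewrite if_same.
Qed.

Lemma sum_delta (R : realType) (p : nat) (k : 'I_p) :
  \sum_(i < p) (i == k)%:R = 1 :> R.
Proof. by rewrite (bigD1 k)//= eqxx big1 ?addr0// => i /negbTE ->. Qed.

Lemma scaled_residual_ortho (R : realType) (p : nat) (a : R) (M : {set 'I_p})
    (j k : 'I_p) : k \in M -> k != j ->
  dotv (scaled_residual a M j) (col k (exchangeable_design p a))^T = 0.
Proof.
move=> kM kj; rewrite dotv_scaled_residual col_exchangeable_design.
rewrite (eq_bigr (fun i => (i == k)%:R + a)); last first.
  by move=> i _; rewrite col_exchangeable_design.
rewrite [\sum_i _](eq_bigr (fun i => (i == k)%:R + a)); last first.
  by move=> i _; rewrite col_exchangeable_design.
rewrite !big_split/= sum_in_delta sum_delta sum_in_const sum_all_const.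
rewrite kM eq_sym (negbTE kj) /gram_excess /=; ring.
Qed.

Lemma dotv_scaled_residual_self (R : realType) (p : nat) (a : R)
    (M : {set 'I_p}) (j : 'I_p) : j \in M ->
  let B := gram_excess p a in
  dotv (scaled_residual a M j) (scaled_residual a M j) =
  (1 + #|M|%:R * B) * (1 + (#|M|%:R - 1) * B).
Proof.
move=> jM B; rewrite dotv_scaled_residual -/B.
rewrite [scaled_residual _ _ _ 0 j]scaled_residualE eqxx jM -/B.
pose f i := (1 + #|M|%:R * B) * (i == j)%:R - B * (i \in M)%:R + a.
rewrite (eq_bigr f); last by move=> i _; rewrite scaled_residualE.
rewrite [\sum_i _](eq_bigr f); last by move=> i _; rewrite scaled_residualE.
rewrite /f !big_split/= !sumrN -!mulr_sumr sum_in_delta sum_delta.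
rewrite sum_in_const sum_all_const sum_mem_all jM /=.
rewrite (eq_bigr (fun=> 1)) => [|i ->]//; rewrite sum_in_const.
by rewrite /B /gram_excess; ring.
Qed.

Lemma gram_excess_sqr (R : realType) (p : nat) (a : R) :
  1 + p%:R * gram_excess p a = (1 + p%:R * a) ^+ 2.
Proof. by rewrite /gram_excess; ring. Qed.

(** For [m = p] this is the square of [1 + p a]; when [B] is negative the
    smaller values of [m] give larger values. *)
Lemma gram_excess_lower (R : realType) (p m : nat) (a : R) :
  (0 < p)%N -> (m <= p)%N -> - p%:R^-1 < a -> 0 < 1 + m%:R * gram_excess p a.
Proof.
move=> p0 mp; rewrite ltrNl -ltrN2 opprK => pa.
have p0' : 0 < p%:R :> R by rewrite ltr0n.
have pa1 : 0 < 1 + p%:R * a.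
  by rewrite -(ltr_pM2l p0') mulrN divff ?gt_eqF// in pa; lra.
have [B0|B0] := leP 0 (gram_excess p a).
  by rewrite ltr_pwDl// mulr_ge0.
have e := gram_excess_sqr p a.
have s0 : 0 < (1 + p%:R * a) ^+ 2 by rewrite exprn_gt0.
rewrite (lt_le_trans s0)// -e lerD2l ler_nM2r// ler_nat//.
Qed.

Lemma residual_scale_gt0 (R : realType) (p : nat) (a : R) (M : {set 'I_p})
    (j : 'I_p) : - p%:R^-1 < a -> j \in M ->
  0 < 1 + (#|M|%:R - 1) * gram_excess p a.
Proof.
move=> pa jM; have -> : #|M|%:R - 1 = #|M :\ j|%:R :> R.
  by rewrite (cardsD1 j M) jM /= natrD addrC addKr.
apply: gram_excess_lower => //; first by rewrite (leq_trans _ (ltn_ord j)).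
by rewrite (leq_trans (max_card _))// card_ord.
Qed.

(** By symmetry the projection of X_j on the other columns of [M] gives them
    all the same weight; the normal equations then read
    [c = B (1 - (m - 1) c)], that is [c = B / (1 + (m - 1) B)]. *)
Lemma residual_exchangeable (R : realType) (p : nat) (a : R)
    (M : {set 'I_p}) (j : 'I_p) : - p%:R^-1 < a -> j \in M ->
  residual (exchangeable_design p a) M j =
  (1 + (#|M|%:R - 1) * gram_excess p a)^-1 *: scaled_residual a M j.
Proof.
move=> pa jM; set X := exchangeable_design p a; set B := gram_excess p a.
set D := 1 + _; set r := D^-1 *: _.
have mE : (#|M|%:R - 1 : R) = #|M :\ j|%:R.
  by rewrite (cardsD1 j M) jM /= natrD addrC addKr.
have D0 : D != 0 by rewrite gt_eqF//; exact: residual_scale_gt0 pa jM.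
pose w := (B / D) *: \sum_(k in M :\ j) (col k X)^T.
have wr : (col j X)^T = w + r.
  apply/rowP => i; rewrite col_exchangeable_design !mxE summxE.
  under eq_bigr do rewrite col_exchangeable_design.
  rewrite big_split/= sum_in_const.
  rewrite (eq_bigr (fun k => (k == i)%:R)); last by move=> k _; rewrite eq_sym.
  rewrite sum_in_delta finset.in_setD1 -mE -/B.
  apply: (mulfI D0); rewrite [RHS]mulrDr mulrA [D * (B / D)]mulrC divfK// mulVKf//.
  rewrite /D; have [->|ij] := eqVneq i j; last by case: (i \in M) => /=; ring.
  by rewrite jM /=; ring.
rewrite /residual; have -> : (col j X)^T *m orthoproj (colspan X (M :\ j)) = w.
  rewrite wr; apply: orthoproj_decomp.
    rewrite /w scalemx_sub// summx_sub// => k kM.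
    by rewrite (submx_trans _ (sumsmx_sup k kM (submx_refl _)))// genmxE.
  apply: colspan_ortho => k; rewrite finset.in_setD1 => /andP[kj kM].
  by rewrite dotvZl scaled_residual_ortho ?mulr0.
by rewrite wr addrAC subrr add0r.
Qed.

(** All that the rest of the proof needs to know about the design: from here
    on no linear algebra remains. *)
Lemma dotv_unit_residual (R : realType) (p : nat) (a : R)
    (M : {set 'I_p}) (j : 'I_p) (z : 'rV[R]_p) : - p%:R^-1 < a -> j \in M ->
  let B := gram_excess p a in
  dotv (unit_residual (exchangeable_design p a) M j) z =
  ((1 + #|M|%:R * B) * z 0 j - B * (\sum_(i in M) z 0 i) + a * \sum_i z 0 i)
  / Num.sqrt ((1 + #|M|%:R * B) * (1 + (#|M|%:R - 1) * B)).
Proof.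
move=> pa jM B; rewrite -(dotv_scaled_residual a M j z) -(dotv_scaled_residual_self a jM).
rewrite /unit_residual residual_exchangeable// /l2norm -/B.
set D := 1 + (_ - _) * _.
have D0 : 0 < D by exact: residual_scale_gt0 pa jM.
rewrite !dotvZl [dotv (scaled_residual _ _ _) (_ *: _)]dotvC dotvZl.
rewrite [in Num.sqrt _]mulrA -expr2 sqrtrM ?sqr_ge0// sqrtr_sqr.
rewrite ger0_norm ?invr_ge0 ?ltW// invfM invrK mulrACA mulfV ?gt_eqF//.
by rewrite mul1r mulrC.
Qed.

(** * Deterministic bounds on the contrasts *)

(** Here [SM] stands for the sum over [M] and [S] for the overall sum.  If
    [a >= 0], then [B >= 0] and the contrast is
    [(1 + (m - 1) B) zj - B (SM - zj) + a S].  If [a < 0], then [B < 0] and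
    [(m - 1) |B|] may be much larger than the denominator when [m] is close to
    [p]; writing [SM = S - (S - SM)] trades the coordinates of [M] for those
    outside [M], of total weight [(p - m) |B| <= 1 - m |B|]. *)
Lemma exchangeable_contrast_le (R : realType) (p m a x zj SM S B : R) :
  B = 2 * a + p * a ^+ 2 -> 1 <= m -> m <= p -> - p^-1 < a -> 0 <= x ->
  `|zj| <= x -> `|SM - zj| <= (m - 1) * x -> `|S - SM| <= (p - m) * x ->
  `|(1 + m * B) * zj - B * SM + a * S| <=
  Num.sqrt ((1 + m * B) * (1 + (m - 1) * B)) * (2 * x + `|S| / Num.sqrt p).
Proof.
move=> BE m1 mp pa x0 zx SMx Sx; set Q := _ * (1 + _).
have p0 : 0 < p by lra.
have p0' : p != 0 by rewrite gt_eqF.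
have pa1 : 0 < 1 + p * a.
  by rewrite -(ltr_pM2l p0) mulrN divff// in pa; lra.
have sq0 : 0 <= Num.sqrt Q by exact: sqrtr_ge0.
have sp0 : 0 < Num.sqrt p by rewrite sqrtr_gt0.
have p2 : Num.sqrt p ^+ 2 = p by rewrite sqr_sqrtr// ltW.
(* u collects z_j, v the other coordinates, and w S the overall sum. *)
suff [u [v [w [-> hu hv hw]]]] : exists u v w : R,
    [/\ (1 + m * B) * zj - B * SM + a * S = u + v + w * S,
        `|u| <= Num.sqrt Q * x, `|v| <= Num.sqrt Q * x
      & `|w| * Num.sqrt p <= Num.sqrt Q].
  rewrite (le_trans (ler_normD _ _))// mulrDr lerD//.
    by rewrite (le_trans (ler_normD _ _))//; lra.
  by rewrite normrM mulrA ler_pdivlMr// mulrAC ler_wpM2r.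
have toQ (c : R) : 0 <= c -> c ^+ 2 <= Q -> c <= Num.sqrt Q.
  by move=> c0 cQ; rewrite -(ger0_norm c0) -sqrtr_sqr ler_wsqrtr.
have [a0|a0] := leP 0 a.
- have B0 : 0 <= B by rewrite BE; nra.
  have mB : 0 <= (m - 1) * B by rewrite mulr_ge0//; lra.
  have cQ : 1 + (m - 1) * B <= Num.sqrt Q.
    by apply: toQ; [lra|rewrite /Q; nra].
  exists ((1 + (m - 1) * B) * zj), (- B * (SM - zj)), a; split.
  + by ring.
  + by rewrite normrM ger0_norm; [apply: ler_pM => //; lra|lra].
  + rewrite normrM normrN (ger0_norm B0) (le_trans (ler_wpM2l B0 SMx))//.
    by rewrite mulrA ler_wpM2r//; lra.
  + rewrite ger0_norm//; apply: toQ; first by rewrite mulr_ge0// ltW.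
    rewrite exprMn p2 /Q.
    have : a ^+ 2 * p <= B by rewrite BE; lra.
    have : B <= m * B by nra.
    by nra.
- have B0 : 0 <= - B by rewrite BE; nra.
  have pB : 1 - p * - B = (1 + p * a) ^+ 2 by rewrite BE; ring.
  have mB : m * - B <= p * - B by rewrite ler_wpM2r.
  have s0 : 0 <= (1 + p * a) ^+ 2 by rewrite sqr_ge0.
  have cQ : 1 + m * B <= Num.sqrt Q by apply: toQ; [lra|rewrite /Q; nra].
  exists ((1 + m * B) * zj), (B * (S - SM)), (a - B); split.
  + by ring.
  + by rewrite normrM ger0_norm; [apply: ler_pM => //; lra|lra].
  + rewrite normrM -normrN (ger0_norm B0) (le_trans (ler_wpM2l B0 Sx))//.
    by rewrite mulrA ler_wpM2r//; lra.
  + have -> : a - B = - a * (1 + p * a) by rewrite BE; ring.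
    have aB : a ^+ 2 * p <= - B by rewrite BE; nra.
    rewrite ger0_norm; last by rewrite mulr_ge0//; lra.
    apply: toQ; first by rewrite !mulr_ge0//; lra.
    rewrite !exprMn p2 sqrrN mulrAC /Q mulrC.
    by apply: ler_pM => //; [rewrite mulr_ge0 ?sqr_ge0//; lra|lra|lra].
Qed.

(** The case [a = 1].  Since [zj] and the other coordinates of [M] have opposite
    signs, their contributions [(m - 1) B x] add up, while the denominator is
    at most [(m + 1) B] because [B >= 1]. *)
Lemma exchangeable_contrast_ge (R : realType) (p m x zj SM S B : R) :
  B = 2 + p -> 1 <= m -> m <= p -> 0 <= x -> x <= zj -> SM - zj <= - ((m - 1) * x) ->
  2 * x * ((m - 1) / (m + 1)) - `|S| / Num.sqrt p <=
  ((1 + m * B) * zj - B * SM + S)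
  / Num.sqrt ((1 + m * B) * (1 + (m - 1) * B)).
Proof.
move=> BE m1 mp x0 xz SMx; set Q := _ * (1 + _).
have p0 : 0 < p by lra.
have B1 : 1 <= B by rewrite BE; lra.
have Bp : p <= B by rewrite BE; lra.
have mB : 0 <= (m - 1) * B by rewrite mulr_ge0//; lra.
have Qp : p <= Q by rewrite /Q; nra.
have Q0 : 0 < Num.sqrt Q by rewrite sqrtr_gt0 (lt_le_trans p0).
have sp0 : 0 < Num.sqrt p by rewrite sqrtr_gt0.
have Qm : Num.sqrt Q <= (m + 1) * B.
  have h : 0 <= (m + 1) * B by rewrite mulr_ge0//; lra.
  by rewrite -[leRHS](ger0_norm h) -sqrtr_sqr ler_wsqrtr// /Q; nra.
have SN : - `|S| <= S by rewrite lerNl -normrN ler_norm.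
have num : 2 * x * ((m - 1) * B) - `|S| <= (1 + m * B) * zj - B * SM + S.
  have : x * ((m - 1) * B) <= zj * ((m - 1) * B) by rewrite ler_wpM2r.
  have : B * (SM - zj) <= B * (- ((m - 1) * x)) by rewrite ler_wpM2l//; lra.
  by nra.
rewrite ler_pdivlMr// (le_trans _ num)// mulrBl lerB//; last first.
  by rewrite -mulrA ler_peMr// mulrC ler_pdivlMr// mul1r ler_wsqrtr.
rewrite -!mulrA ler_wpM2l// ler_wpM2l// ler_wpM2l//; first lra.
by rewrite mulrC ler_pdivrMr; [rewrite mulrC|lra].
Qed.
Lemma sum_norm_le (R : realType) (I : finType) (P : pred I) (f : I -> R) x :
  (forall i, P i -> `|f i| <= x) -> `|\sum_(i | P i) f i| <= #|P|%:R * x.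
Proof.
move=> h; rewrite (le_trans (ler_norm_sum _ _ _))// (le_trans (ler_sum _ h))//.
by rewrite sumr_const mulr_natl.
Qed.

Lemma posi_stat_le (R : realType) (p : nat) (a x : R) (z : 'rV[R]_p) :
  - p%:R^-1 < a -> 0 <= x -> (forall i, `|z 0 i| <= x) ->
  posi_stat (exchangeable_design p a) z <=
  2 * x + `|\sum_i z 0 i| / Num.sqrt p%:R.
Proof.
move=> pa x0 zx.
have rhs0 : 0 <= 2 * x + `|\sum_i z 0 i| / Num.sqrt p%:R.
  by rewrite addr_ge0 ?mulr_ge0 ?invr_ge0 ?sqrtr_ge0.
apply: bigmax_le => // M _; apply: bigmax_le => // j jM.
rewrite dotv_unit_residual//.
have m1 : (1 <= #|M|)%N by apply/card_gt0P; exists j.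
have mp : (#|M| <= p)%N by rewrite (leq_trans (max_card _))// card_ord.
have B0 := @gram_excess_lower R p #|M| a (leq_trans m1 mp) mp pa.
have B1 := residual_scale_gt0 pa jM.
rewrite normrM normfV (ger0_norm (sqrtr_ge0 _)) ler_pdivrMr; last first.
  by rewrite sqrtr_gt0 mulr_gt0.
rewrite [leRHS]mulrC; apply: exchangeable_contrast_le => //.
- by rewrite ler1n.
- by rewrite ler_nat.
- rewrite (big_setD1 j jM)/= addrAC subrr add0r.
  have -> : #|M|%:R - 1 = #|M :\ j|%:R :> R.
    by rewrite (cardsD1 j M) jM natrD/= addrAC subrr add0r.
  apply: sum_norm_le => i _; exact: zx.
- rewrite -natrB//.
  have -> : \sum_i z 0 i - \sum_(i in M) z 0 i = \sum_(i in ~: M) z 0 i.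
    rewrite (bigID (mem M))/= addrAC subrr add0r.
    by apply: eq_bigl => i; rewrite inE.
  have -> : (p - #|M|)%N = #|~: M|.
    have h := cardsC M; rewrite card_ord in h.
    by apply/eqP; rewrite -(eqn_add2l #|M|) h subnKC.
  by apply: sum_norm_le => i _; exact: zx.
Qed.

Lemma posi_stat_ge (R : realType) (p : nat) (x : R) (z : 'rV[R]_p)
    (M : {set 'I_p}) (j : 'I_p) : 0 <= x -> j \in M ->
  x <= z 0 j -> (forall k, k \in M -> k != j -> z 0 k <= - x) ->
  2 * x * ((#|M|%:R - 1) / (#|M|%:R + 1)) - `|\sum_i z 0 i| / Num.sqrt p%:R <=
  posi_stat (exchangeable_design p 1) z.
Proof.
move=> x0 jM zj zk.
have m1 : (1 <= #|M|)%N by apply/card_gt0P; exists j.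
have mp : (#|M| <= p)%N by rewrite (leq_trans (max_card _))// card_ord.
have M0 : M != finset.set0 by rewrite -card_gt0.
have p1 : - p%:R^-1 < 1 :> R by rewrite (@le_lt_trans _ _ 0)// oppr_le0 invr_ge0.
apply: (bigmax_sup M) => //.
apply: (bigmax_sup j) => //.
apply: (le_trans _ (ler_norm _)).
rewrite dotv_unit_residual// mul1r; apply: exchangeable_contrast_ge => //.
- by rewrite /gram_excess mulr1 expr1n mulr1.
- by rewrite ler1n.
- by rewrite ler_nat.
- rewrite (big_setD1 j jM)/= addrAC subrr add0r.
  have mE : #|M|%:R - 1 = #|M :\ j|%:R :> R.
    by rewrite (cardsD1 j M) jM natrD/= addrAC subrr add0r.
  rewrite mE -mulrN mulr_natl -sumr_const; apply: ler_sum => i.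
  by rewrite finset.in_setD1 => /andP[ij iM]; exact: zk.
Qed.

(** * Standard normal variables *)

(** The density is even and Lebesgue measure is invariant under reflection. *)
Lemma normal_probN (R : realType) (B : set R) : measurable B ->
  normal_prob 0 1 (-%R @^-1` B) = normal_prob 0 1 B :> \bar R.
Proof.
move=> mB; rewrite /normal_prob.
have even_pdf (x : R) : normal_pdf 0 1 (- x) = normal_pdf 0 1 x.
  by rewrite !normal_pdfE ?oner_neq0// /normal_fun !subr0 sqrrN.
have mpdf : measurable_fun [set: R] (EFin \o normal_pdf (0 : R) 1).
  by apply/measurable_EFinP; exact: measurable_normal_pdf.
have mN : measurable_fun [set: measurableTypeR R]
    (-%R : measurableTypeR R -> measurableTypeR R) by exact: oppr_measurable.
transitivity (\int[pushforward lebesgue_measure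
    (-%R : measurableTypeR R -> measurableTypeR R)]_(x in B)
    (EFin \o normal_pdf 0 1) x)%E; last first.
  by apply: eq_measure_integral => A mA _; exact: lebesgue_measureN.
rewrite (ge0_integral_pushforward mN)//=.
- by apply: eq_integral => x _; rewrite even_pdf.
- by apply: measurable_funTS.
- by move=> x _; rewrite lee_fin normal_pdf_ge0.
Qed.

(** For [y >= x >= 0], [y ^ 2 >= x ^ 2 + (y - x) ^ 2], so on the ray the
    density of N(0, 1) is at most [exp (- x ^ 2 / 2)] times that of N(x, 1),
    whose total mass is 1. *)
Lemma normal_prob_ray_le (R : realType) (x : R) : 0 <= x ->
  (normal_prob 0 1 `[x, +oo[ <= (expR (- (x ^+ 2 / 2)))%:E)%E.
Proof.
move=> x0; rewrite /normal_prob.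
have mpdf (m : R) : measurable_fun [set: R] (fun y => (normal_pdf m 1 y)%:E).
  by apply/measurable_EFinP; exact: measurable_normal_pdf.
apply: (@le_trans _ _ (\int[lebesgue_measure]_(y in `[x, +oo[)
    ((expR (- (x ^+ 2 / 2)))%:E * (normal_pdf x 1 y)%:E))%E).
  apply: ge0_le_integral => //=.
  - by move=> y _; rewrite lee_fin normal_pdf_ge0.
  - by apply: measurable_funTS; exact: mpdf.
  - by apply: measurable_funTS; apply: measurable_funeM; exact: mpdf.
  - move=> y; rewrite in_itv/= andbT => xy; rewrite -EFinM lee_fin.
    rewrite !normal_pdfE ?oner_neq0// mulrCA ler_wpM2l ?normal_peak_ge0//.
    rewrite /normal_fun -expRD ler_expR subr0 expr1n -mulr_natr.
    by rewrite mul1r; nra.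
rewrite ge0_integralZl//=.
- rewrite -[leRHS]mule1 lee_wpmul2l ?lee_fin ?expR_ge0//.
  rewrite -(integral_normal_pdf x 1); apply: ge0_subset_integral => //=.
    exact: mpdf.
  by move=> y _; rewrite lee_fin normal_pdf_ge0.
- by apply: measurable_funTS; exact: mpdf.
- by move=> y _; rewrite lee_fin normal_pdf_ge0.
Qed.

(** Keep only the interval [x, x + 1], where the density is at least its value
    at the right end.  The loss with respect to the true order of magnitude is
    a lower order term in the exponent. *)
Lemma normal_prob_ray_ge (R : realType) (x : R) : 0 <= x ->
  ((normal_peak 1 * expR (- ((x + 1) ^+ 2 / 2)))%:E
   <= normal_prob 0 1 `[x, +oo[)%E.
Proof.
move=> x0; have [y yE] : exists y, y = x + 1 by exists (x + 1).
rewrite -yE /normal_prob.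
have mpdf : measurable_fun [set: R] (fun t : R => (normal_pdf 0 1 t)%:E).
  by apply/measurable_EFinP; exact: measurable_normal_pdf.
apply: (@le_trans _ _ (\int[lebesgue_measure]_(t in `[x, y])
    (normal_pdf 0 1 t)%:E)%E); last first.
  apply: ge0_subset_integral => //=.
  - by apply: measurable_funTS.
  - by move=> t _; rewrite lee_fin normal_pdf_ge0.
  - by move=> t/=; rewrite !in_itv/= => /andP[->].
apply: (@le_trans _ _ (\int[lebesgue_measure]_(t in `[x, y])
    (normal_peak 1 * expR (- (y ^+ 2 / 2)))%:E)%E).
  rewrite integral_cst//= lebesgue_measure_itv/= lte_fin yE ltrDl ltr01.
  by rewrite -EFinD addrAC subrr add0r mule1.
apply: ge0_le_integral => //=.
- by move=> t _; rewrite lee_fin mulr_ge0 ?normal_peak_ge0 ?expR_ge0.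
- by apply: measurable_funTS.
- move=> t; rewrite in_itv/= => /andP[xt ty]; rewrite lee_fin.
  rewrite normal_pdfE ?oner_neq0// ler_wpM2l ?normal_peak_ge0//.
  by rewrite /normal_fun ler_expR subr0 expr1n -mulr_natr mul1r; nra.
Qed.

Lemma measurable_ge_set d (T : measurableType d) (R : realType) (f : T -> R)
    (c : R) : measurable_fun setT f -> measurable [set w | c <= f w].
Proof.
move=> mf; have -> : [set w | c <= f w] = f @^-1` `[c, +oo[%classic.
  by apply/seteqP; split => w /=; rewrite in_itv/= andbT.
by rewrite -[X in measurable X]setTI; exact: mf.
Qed.

Lemma measurable_le_set d (T : measurableType d) (R : realType) (f : T -> R)
    (c : R) : measurable_fun setT f -> measurable [set w | f w <= c].
Proof.
move=> mf; have -> : [set w | f w <= c] = f @^-1` `]-oo, c]%classic.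
  by apply/seteqP; split => w /=; rewrite in_itv.
by rewrite -[X in measurable X]setTI; exact: mf.
Qed.

Section standard_normal.
Local Open Scope ereal_scope.
Context d (T : measurableType d) (R : realType) (P : probability T R).

Definition std_normal (X : {RV P >-> R}) := forall B : set R, measurable B ->
  distribution P X B = normal_prob 0%R 1%R B.

Lemma std_normal_opp (X : {RV P >-> R}) (B : set R) : std_normal X ->
  measurable B -> P ((fun w => - X w)%R @^-1` B) = normal_prob 0%R 1%R B.
Proof.
move=> NX mB; rewrite -normal_probN// -NX//.
by rewrite -[X in measurable X]setTI; exact: oppr_measurable.
Qed.

Lemma std_normal_ray_le (X : {RV P >-> R}) (x : R) : std_normal X ->
  (0 <= x)%R -> P [set w | (x <= `|X w|)%R] <= (2 * expR (- (x ^+ 2 / 2)))%:E.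
Proof.
move=> NX x0.
have mX : measurable_fun [set: T] (fun w => - X w)%R by exact: measurable_funN.
have -> : [set w | (x <= `|X w|)%R] =
    (X @^-1` `[x, +oo[) `|` ((fun w => - X w)%R @^-1` `[x, +oo[).
  apply/seteqP; split => w /=; rewrite !in_itv/= !andbT ler_normr.
    by move=> /orP.
  by move=> h; apply/orP.
have mA : measurable (X @^-1` `[x, +oo[%classic).
  by rewrite -[X in measurable X]setTI; exact: measurable_funP.
have mB : measurable ((fun w => - X w)%R @^-1` `[x, +oo[%classic).
  by rewrite -[X in measurable X]setTI; exact: mX.
apply: le_trans (measureU2 _ _ _) _ => //.
rewrite mulrDl !mul1r EFinD; apply: leeD.
  by apply: le_trans (normal_prob_ray_le x0); rewrite -NX.
by apply: le_trans (normal_prob_ray_le x0); rewrite -(std_normal_opp NX).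
Qed.

(** Layer-cake formula: [P (X ^ 2 > r) <= 2 exp (- r / 2)], which is four times
    the density of the exponential law of rate 1/2.  The
    constant 4 is not sharp; any finite bound serves the same purpose. *)
Lemma std_normal_sqr (X : {RV P >-> R}) : std_normal X ->
  \int[P]_w ((X w) ^+ 2)%:E <= 4%:E.
Proof.
move=> NX.
pose Y := (X ^+ 2)%R : {RV P >-> R}.
have := @ge0_expectation_ccdf _ _ _ P Y (fun w => sqr_ge0 (X w)).
rewrite unlock => ->.
have e0 : (0 < 2^-1 :> R)%R by [].
have mE : measurable_fun [set: R] (EFin \o exponential_pdf (2^-1 : R)%R).
  by apply/measurable_EFinP; exact: measurable_exponential_pdf.
apply: (@le_trans _ _ (\int[lebesgue_measure]_(r in `[0%R, +oo[)
    (4%:E * (exponential_pdf 2^-1 r)%:E))).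
  apply: ge0_le_integral => //=.
  - by apply: measurable_funTS; exact: ccdf_measurable.
  - by apply: measurable_funTS; apply: measurable_funeM; exact: mE.
  - move=> r; rewrite in_itv/= andbT => r0.
    rewrite exponential_pdfE// -EFinM mulrA.
    have -> : (4 * 2^-1 = 2 :> R)%R by lra.
    have -> : (expR (- 2^-1 * r) = expR (- (Num.sqrt r ^+ 2 / 2)))%R.
      by rewrite sqr_sqrtr// mulNr mulrC.
    apply: le_trans (std_normal_ray_le NX (sqrtr_ge0 r)).
    apply: (@le_measure _ _ _ P (Y @^-1` `]r, +oo[%classic)); rewrite ?inE//=.
    + by rewrite -[X in measurable X]setTI; exact: measurable_funP.
    + by apply: measurable_ge_set; exact: measurableT_comp.
    + move=> w /=; rewrite in_itv/= andbT => rY.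
      have /ltW rX : (r < X w ^+ 2)%R by exact: rY.
      by rewrite -sqrtr_sqr ler_wsqrtr.
rewrite ge0_integralZl//=.
- rewrite -[leRHS]mule1 lee_wpmul2l ?lee_fin//.
  rewrite -(integral_exponential_pdf e0); apply: ge0_subset_integral => //=.
  by move=> r _; rewrite lee_fin exponential_pdf_ge0.
- by apply: measurable_funTS; exact: mE.
- by move=> r _; rewrite lee_fin exponential_pdf_ge0.
Qed.

End standard_normal.

(** * The sum of independent standard normal variables *)

Section independent_gaussians.
Local Open Scope ereal_scope.
Context d (T : measurableType d) (R : realType) (P : probability T R).

Lemma std_gaussian_normal p (Z : 'I_p -> {RV P >-> R}) i :
  std_gaussian Z -> std_normal (Z i).
Proof. by move=> [_ +] B mB; apply. Qed.

(** Mutual independence with no constraint on the other coordinates. *)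
Lemma mutually_independent_pair p (Z : 'I_p -> {RV P >-> R}) i j (A B : set R) :
  mutually_independent Z -> i != j -> measurable A -> measurable B ->
  P (Z i @^-1` A `&` Z j @^-1` B) = P (Z i @^-1` A) * P (Z j @^-1` B).
Proof.
move=> indZ ij mA mB.
pose C k := if k == i then A else if k == j then B else setT.
have mC k : measurable (C k) by rewrite /C; case: ifP => // _; case: ifP.
have ji : (j == i) = false by rewrite eq_sym (negbTE ij).
have := indZ C mC; rewrite (bigD1 i)//= (bigD1 j)//=; last by rewrite eq_sym.
rewrite big1 ?mule1; last first.
  move=> k /andP[ki kj]; rewrite /C (negbTE ki) (negbTE kj).
  by rewrite preimage_setT probability_setT.
rewrite /C eqxx ji eqxx => <-; congr (P _).
apply/seteqP; split => [w [Aw Bw] k _|w h] /=.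
  by case: eqVneq => [->//|_]; case: eqVneq => [->|].
split; first by have := h i Logic.I; rewrite /= eqxx.
by have := h j Logic.I; rewrite /= ji eqxx.
Qed.

Lemma std_normal_integrable_mul (X Y : {RV P >-> R}) :
  std_normal X -> std_normal Y ->
  P.-integrable setT (fun w => (X w * Y w)%:E).
Proof.
move=> NX NY; apply/integrableP; split.
  by apply/measurable_EFinP; exact: measurable_funM.
have sqlt (U : {RV P >-> R}) : std_normal U ->
    \int[P]_w ((U w) ^+ 2)%:E < +oo.
  by move=> /std_normal_sqr /le_lt_trans; apply; exact: ltry.
have mS (U : {RV P >-> R}) : measurable_fun setT (fun w => ((U w) ^+ 2)%:E).
  by apply/measurable_EFinP; exact: measurable_funX.
apply: (@le_lt_trans _ _ (\int[P]_w (((X w) ^+ 2)%:E + ((Y w) ^+ 2)%:E))).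
  apply: ge0_le_integral => //=.
  - by apply/measurable_EFinP; apply: measurableT_comp => //; exact: measurable_funM.
  - exact: emeasurable_funD.
  - move=> w _; rewrite lee_fin normrM.
    have := sqr_ge0 (`|X w| - `|Y w|)%R.
    rewrite -(real_normK (num_real (X w))) -(real_normK (num_real (Y w))).
    have : (0 <= `|X w| * `|Y w|)%R by rewrite mulr_ge0.
    by nra.
rewrite ge0_integralD//=.
- by apply: lte_add_pinfty; exact: sqlt.
- by move=> w _; rewrite lee_fin sqr_ge0.
- by move=> w _; rewrite lee_fin sqr_ge0.
Qed.

(** By symmetry of the law of [X], the pairs [(X, Y)] and [(- X, Y)] have the
    same law, namely the product law; hence [E (X Y) = - E (X Y)]. *)
Lemma std_normal_uncorrelated (X Y : {RV P >-> R}) :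
  std_normal X -> std_normal Y ->
  (forall A B : set R, measurable A -> measurable B ->
    P (X @^-1` A `&` Y @^-1` B) = P (X @^-1` A) * P (Y @^-1` B)) ->
  \int[P]_w (X w * Y w)%:E = 0.
Proof.
move=> NX NY XY.
have m1 : measurable_fun setT (fun w => (X w, Y w)).
  exact: measurable_fun_pair.
have m2 : measurable_fun setT (fun w => ((- X w)%R, Y w)).
  by apply: measurable_fun_pair => //; exact: measurable_funN.
pose F1 : {mfun T >-> (R * R)%type} :=
  HB.pack (fun w => (X w, Y w)) (isMeasurableFun.Build _ _ _ _ _ m1).
pose F2 : {mfun T >-> (R * R)%type} :=
  HB.pack (fun w => ((- X w)%R, Y w)) (isMeasurableFun.Build _ _ _ _ _ m2).
have law1 (A B : set R) : measurable A -> measurable B ->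
    distribution P F1 (A `*` B) = distribution P X A * distribution P Y B.
  by move=> mA mB; exact: XY.
have law2 (A B : set R) : measurable A -> measurable B ->
    distribution P F2 (A `*` B) = distribution P X A * distribution P Y B.
  move=> mA mB; rewrite NX// -(std_normal_opp NX mA).
  have mA' : measurable (-%R @^-1` A).
    by rewrite -[Y in measurable Y]setTI; exact: oppr_measurable.
  by have := XY _ _ mA' mB.
pose f (z : R * R) := (z.1 * z.2)%:E.
have mf : measurable_fun [set: R * R] f.
  by apply/measurable_EFinP; apply: measurable_funM.
have int1 : P.-integrable setT (f \o F1) by exact: std_normal_integrable_mul.
have oppE : f \o F2 = \- (f \o F1).
  by apply/funext => w; rewrite /f /= mulNr EFinN.
have int2 : P.-integrable setT (f \o F2) by rewrite oppE; exact: integrableN.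
have e1 := integral_distribution (X := F1) mf int1.
have e2 := integral_distribution (X := F2) mf int2.
have e12 : \int[distribution P F1]_y f y = \int[distribution P F2]_y f y.
  apply: eq_measure_integral => A mA _.
  have h1 := @product_measure_unique _ _ _ _ R (distribution P X)
    (distribution P Y) (distribution P F1) law1 A mA.
  have h2 := @product_measure_unique _ _ _ _ R (distribution P X)
    (distribution P Y) (distribution P F2) law2 A mA.
  exact: etrans (esym h1) h2.
have oppI : \int[P]_w (f \o F2) w = - \int[P]_w (f \o F1) w.
  rewrite -mulN1e -integralZl//; apply: eq_integral => w _.
  by rewrite mulN1e oppE.
move: e12; rewrite e1 e2 oppI.
have : \int[P]_w (f \o F1) w \is a fin_num by exact: integrable_fin_num.
rewrite -[\int[P]_w (X w * Y w)%:E]/(\int[P]_w (f \o F1) w).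
case: (\int[P]_w (f \o F1) w) => // r _ /eqP; rewrite -EFinN eqe => /eqP h.
by congr EFin; lra.
Qed.

(** Only the diagonal terms of the expanded square survive. *)
Lemma gaussian_sum_sqr p (Z : 'I_p -> {RV P >-> R}) : std_gaussian Z ->
  \int[P]_w ((\sum_i Z i w) ^+ 2)%:E <= (4 * p%:R)%:E.
Proof.
move=> GZ; have NZ i := std_gaussian_normal i GZ.
have intZ i j : P.-integrable setT (fun w => (Z i w * Z j w)%:E).
  exact: std_normal_integrable_mul.
under eq_integral => w _.
  rewrite expr2 mulr_suml -sumEFin.
  under eq_bigr do rewrite mulr_sumr -sumEFin.
  over.
rewrite integral_sum//=; last first.
  by move=> i; apply: integrable_sum => // j _; exact: intZ.
have -> : (4 * p%:R)%:E = \sum_(i < p) 4%:E :> \bar R.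
  by rewrite sumEFin sumr_const card_ord mulr_natr.
apply: lee_sum => i _; rewrite integral_sum// (bigD1 i)//= big1 ?adde0.
  by under eq_integral do rewrite -expr2; exact: std_normal_sqr.
move=> j ji; apply: std_normal_uncorrelated => // A B mA mB.
by apply: mutually_independent_pair => //; [case: GZ|rewrite eq_sym].
Qed.

Lemma gaussian_sum_tail p (Z : 'I_p -> {RV P >-> R}) (c : R) :
  std_gaussian Z -> (0 < c)%R ->
  P [set w | (c <= `|(\sum_i Z i w)%R|)%R] <= (4 * p%:R / c ^+ 2)%:E.
Proof.
move=> GZ c0.
have mS : measurable_fun setT (fun w => (\sum_i Z i w)%R).
  exact: measurable_sum.
pose S : {RV P >-> R} :=
  HB.pack (fun w => (\sum_i Z i w)%R) (isMeasurableFun.Build _ _ _ _ _ mS).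
have sq_nd : {in Num.nneg &, {homo (fun x : R => x ^+ 2)%R : x y / (x <= y)%R}}.
  by move=> x y; rewrite !nnegrE => x0 y0; rewrite ler_sqr.
have sq0 (r : R) : (0 <= r -> 0 <= r ^+ 2)%R by move=> _; exact: sqr_ge0.
have := @markov _ _ _ P S (fun x => x ^+ 2)%R c c0 (exprn_measurable 2) sq0 sq_nd => h.
rewrite EFinM lee_pdivlMr ?exprn_gt0// muleC.
apply: le_trans h (le_trans _ (gaussian_sum_sqr GZ)); rewrite unlock/=.
rewrite le_eqVlt; apply/orP; left; apply/eqP; apply: eq_integral => w _.
by rewrite real_normK ?num_real.
Qed.

End independent_gaussians.

(** * From tail bounds to the PoSI constant *)

Section union_bound.
Context d (T : measurableType d) (R : realType) (P : probability T R).

Lemma mem_bigsetU (I : finType) (A : I -> set T) i w :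
  A i w -> (\big[setU/set0]_i A i) w.
Proof. by move=> Aw; rewrite (bigD1 i)//=; left. Qed.

Lemma probability_bigsetU_le (I : finType) (A : I -> set T) (b : R) :
  (forall i, measurable (A i)) -> (forall i, (P (A i) <= b%:E)%E) ->
  (P (\big[setU/set0]_i A i) <= (#|I|%:R * b)%:E)%E.
Proof.
move=> mA Ab; apply: (@le_trans _ _ (\sum_(i : I) P (A i))%E).
  suff [] : measurable (\big[setU/set0]_i A i) /\
      (P (\big[setU/set0]_i A i) <= \sum_(i : I) P (A i))%E by [].
  apply: (big_rec2 (fun U s => measurable U /\ (P U <= s)%E)).
    by rewrite measure0.
  move=> i s U _ [mU Us]; split; first exact: measurableU.
  by apply: le_trans (measureU2 _ (mA i) mU) _; exact: leeD2l.
apply: (@le_trans _ _ (\sum_(i : I) b%:E)%E); first exact: lee_sum.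
by rewrite sumEFin sumr_const mulr_natl.
Qed.

Lemma probability_union2_le (A B C : set T) (a b : R) : measurable A ->
  measurable B -> measurable C -> A `<=` B `|` C ->
  (P B <= a%:E)%E -> (P C <= b%:E)%E -> (P A <= (a + b)%:E)%E.
Proof.
move=> mA mB mC ABC Pa Pb.
apply: (@le_trans _ _ (P (B `|` C))).
  by apply: le_measure => //; rewrite inE//; exact: measurableU.
by apply: le_trans (measureU2 _ mB mC) _; rewrite EFinD; exact: leeD.
Qed.

End union_bound.

Lemma measurable_bigmaxr d (T : measurableType d) (R : realType) (I : Type)
    (s : seq I) (Q : pred I) (f : I -> T -> R) :
  (forall i, measurable_fun setT (f i)) ->
  measurable_fun setT (fun w => \big[Num.max/0]_(i <- s | Q i) f i w).
Proof.
move=> mf; elim: s => [|i s ih].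
  by under eq_fun do rewrite big_nil; exact: measurable_cst.
under eq_fun do rewrite big_cons; case: (Q i) => //.
by apply: measurable_maxr.
Qed.

Section posi.
Context d (T : measurableType d) (R : realType) (P : probability T R).
Context (p : nat) (Z : 'I_p -> {RV P >-> R}).

Lemma measurable_posi_stat (X : 'M[R]_p) :
  measurable_fun setT (fun w => posi_stat X (\row_i Z i w)).
Proof.
apply: measurable_bigmaxr => M; apply: measurable_bigmaxr => j.
apply: measurableT_comp => //.
under eq_fun do rewrite dotvE.
apply: measurable_sum => i; apply: measurable_funM => //.
rewrite (_ : (fun _ => _) = Z i); last by apply/funext => w; rewrite mxE.
exact: measurable_funPT.
Qed.

Lemma measurable_posi_event (X : 'M[R]_p) (K : R) :
  measurable [set w | posi_stat X (\row_i Z i w) <= K].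
Proof. by apply: measurable_le_set; exact: measurable_posi_stat. Qed.

Lemma measurable_sum_event (c : R) : measurable [set w | c <= `|\sum_i Z i w|].
Proof.
by apply: measurable_ge_set; apply: measurableT_comp => //; exact: measurable_sum.
Qed.

Lemma posi_stat_ge0 (X : 'M[R]_p) z : 0 <= posi_stat X z.
Proof.
rewrite /posi_stat; elim/big_ind: _ => //; first by move=> x y x0 _; rewrite le_max x0.
by move=> M _; elim/big_ind: _ => // x y x0 _; rewrite le_max x0.
Qed.

(** Outside of the exceptional event, all the [|Z_i|] are below [x] and
    [|sum_i Z_i|] is below [c], so that [posi_stat_le] applies. *)
Lemma posi_stat_tail (a x c : R) : std_gaussian Z -> - p%:R^-1 < a ->
  0 <= x -> 0 < c ->
  (P (~` [set w | (posi_stat (exchangeable_design p a) (\row_i Z i w)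
                   <= 2 * x + c / Num.sqrt p%:R)%R])
   <= (p%:R * (2 * expR (- (x ^+ 2 / 2))) + 4 * p%:R / c ^+ 2)%:E)%E.
Proof.
move=> GZ pa x0 c0; pose A i := [set w | x <= `|Z i w|].
have mA i : measurable (A i).
  by apply: measurable_ge_set; exact: measurableT_comp.
apply: (@probability_union2_le _ _ _ _ _ (\big[setU/set0]_i A i)
  [set w | c <= `|\sum_i Z i w|]).
- by apply: measurableC; exact: measurable_posi_event.
- by apply: bigsetU_measurable.
- exact: measurable_sum_event.
- move=> w /= /negP; rewrite -ltNge => Kw.
  have [[i xZ]|xZ] := pselect (exists i, x <= `|Z i w|).
    by left; apply: (mem_bigsetU (i := i)).
  right; rewrite leNgt; apply/negP => Sc; move: Kw; apply/negP; rewrite -leNgt.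
  apply: le_trans (posi_stat_le pa x0 _) _.
    move=> i; rewrite mxE leNgt; apply/negP => /ltW xi; apply: xZ.
    by exists i.
  rewrite lerD2l ler_wpM2r// ?invr_ge0 ?sqrtr_ge0//.
  by under eq_bigr do rewrite mxE; exact: ltW.
- have := @probability_bigsetU_le _ _ _ P _ A (2 * expR (- (x ^+ 2 / 2))) mA.
  rewrite card_ord; apply => i; apply: std_normal_ray_le => //.
  exact: std_gaussian_normal.
- exact: gaussian_sum_tail.
Qed.

(** The levels over which the infimum is taken are nonnegative, because the
    statistic is; this is where [alpha < 1] is needed. *)
Lemma posi_constant_le (X : 'M[R]_p) (alpha K : R) : alpha < 1 ->
  (P (~` [set w | (posi_stat X (\row_i Z i w) <= K)%R]) <= alpha%:E)%E ->
  posi_constant Z X alpha <= K.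
Proof.
move=> a1 PK; apply: ge_inf.
  exists 0 => L /= PL; rewrite leNgt; apply/negP => L0; move: PL.
  rewrite (_ : [set w | _] = set0) ?measure0 ?lee_fin ?subr_le0 ?leNgt ?a1//.
  apply/seteqP; split => w //= h.
  by have := lt_le_trans (le_lt_trans h L0) (posi_stat_ge0 X (\row_i Z i w)); rewrite ltxx.
move: PK => /=; rewrite probability_setC; last exact: measurable_posi_event.
have := fin_num_measure P _ (measurable_posi_event X K).
by case: (P _) => [r _| |]; rewrite ?leey// -EFinB !lee_fin; lra.
Qed.

(** The level [L] only witnesses that the set of admissible levels is not
    empty: the infimum of the empty set is 0 by convention, which would be no
    upper bound for [K]. *)
Lemma posi_constant_ge (X : 'M[R]_p) (alpha K L : R) :
  (P (~` [set w | (posi_stat X (\row_i Z i w) <= L)%R]) <= alpha%:E)%E ->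
  (forall K', K' < K ->
    (P [set w | (posi_stat X (\row_i Z i w) <= K')%R] < (1 - alpha)%:E)%E) ->
  K <= posi_constant Z X alpha.
Proof.
move=> PL PK; apply: lb_le_inf.
  exists L => /=; move: PL; rewrite probability_setC; last exact: measurable_posi_event.
  have := fin_num_measure P _ (measurable_posi_event X L).
  by case: (P _) => [r _| |]; rewrite ?leey// -EFinB !lee_fin; lra.
move=> K' /= h; rewrite leNgt; apply/negP => /PK; rewrite ltNge => /negP; exact.
Qed.

End posi.

(** * Large coordinates of both signs *)

Lemma card_block_ge (p n r : nat) : (0 < n)%N -> (r.+1 * n <= p)%N ->
  (n <= #|[pred i : 'I_p | (i %/ n)%N == r]|)%N.
Proof.
move=> n0 rn; have lt (k : 'I_n) : (r * n + k < p)%N.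
  by rewrite (leq_trans _ rn)// mulSnr ltn_add2l.
pose f k := Ordinal (lt k).
have f_inj : injective f by move=> k l [/addnI /val_inj].
rewrite -[X in (X <= _)%N](card_ord n) -(card_codom f_inj).
apply: subset_leq_card; apply/fintype.subsetP => _ /codomP[k ->].
by rewrite inE /= divnMDl// divn_small// addn0.
Qed.

Section blocks.
Context d (T : measurableType d) (R : realType) (P : probability T R).
Context (p : nat) (Z : 'I_p -> {RV P >-> R}).

(** By independence the probability that a block of at least [n] indices avoids
    [A] is at most [(1 - q) ^ n <= exp (- n q)].  The event is a cylinder: the
    coordinates outside of the block are left unconstrained. *)
Lemma block_miss_probability (n r : nat) (A : set R) (q : R) :
  std_gaussian Z -> (0 < n)%N -> (r.+1 * n <= p)%N -> measurable A ->
  0 <= q -> (q%:E <= normal_prob 0%R 1%R A)%E ->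
  measurable [set w | forall i : 'I_p, (i %/ n)%N = r -> ~ A (Z i w)] /\
  (P [set w | forall i : 'I_p, (i %/ n)%N = r -> ~ A (Z i w)]
   <= (expR (- (n%:R * q)))%:E)%E.
Proof.
move=> GZ n0 rn mA q0 qA.
pose B (i : 'I_p) : set R := if (i %/ n)%N == r then ~` A else setT.
have mB i : measurable (B i).
  by rewrite /B; case: ifP => _ //; exact: measurableC.
have -> : [set w | forall i : 'I_p, (i %/ n)%N = r -> ~ A (Z i w)] =
    \bigcap_(i in [set: 'I_p]) (Z i @^-1` B i).
  apply/seteqP; split => w h i /=.
    by move=> _; rewrite /B; case: eqP => // ir; exact: h.
  by move=> ir; have := h i Logic.I; rewrite /= /B ir eqxx.
split.
  apply: fin_bigcap_measurable => // i _.
  by rewrite -[X in measurable X]setTI; exact: measurable_funPT.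
rewrite GZ.1//.
have [Q QE] : exists Q : R, normal_prob 0%R 1%R A = Q%:E.
  exists (fine (normal_prob 0%R 1%R A)); rewrite fineK//.
  exact: (fin_num_measure (normal_prob (0 : R) 1)).
have Q1 : Q <= 1 by rewrite -lee_fin -QE; exact: (@probability_le1 _ _ _ (normal_prob (0 : R) 1)).
have qQ : q <= Q by rewrite -lee_fin -QE.
have PB i : P (Z i @^-1` B i) = (if (i %/ n)%N == r then 1 - Q else 1)%:E.
  rewrite /B; case: ifP => _; last by rewrite preimage_setT probability_setT.
  rewrite preimage_setC probability_setC; last first.
    by rewrite -[X in measurable X]setTI; exact: measurable_funPT.
  by have /= := GZ.2 i A mA; rewrite /distribution /pushforward => ->; rewrite QE EFinB.
under eq_bigr do rewrite PB.
rewrite prodEFin lee_fin -big_mkcond/= prodr_const.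
have Q10 : 0 <= 1 - Q by lra.
apply: (@le_trans _ _ ((1 - Q) ^+ n)).
  by apply: ler_wiXn2l; [lra|lra|exact: card_block_ge].
rewrite -mulrN expRM_natl; apply: lerXn2r; rewrite ?nnegrE ?expR_ge0//.
by apply: le_trans (expR_ge1Dx (- q)); lra.
Qed.

(** One looks for a large positive coordinate in the block 0 and for a large
    negative one in each of the blocks 1, ..., m - 1.  Unless some block fails
    or the overall sum is large, the chosen indices form a model of size [m] to
    which [posi_stat_ge] applies. *)
Lemma posi_stat_lower_tail (m n : nat) (x c q K : R) :
  std_gaussian Z -> (0 < m)%N -> (0 < n)%N -> (m * n <= p)%N ->
  0 <= x -> 0 < c -> 0 <= q -> (q%:E <= normal_prob 0%R 1%R `[x, +oo[%classic)%E ->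
  K < 2 * x * ((m%:R - 1) / (m%:R + 1)) - c / Num.sqrt p%:R ->
  (P [set w | (posi_stat (exchangeable_design p 1) (\row_i Z i w) <= K)%R]
   <= (m%:R * expR (- (n%:R * q)) + 4 * p%:R / c ^+ 2)%:E)%E.
Proof.
move=> GZ m0 n0 mn x0 c0 q0 qx Kx.
pose A (r : 'I_m) : set R :=
  if r == 0%N :> nat then `[x, +oo[%classic else -%R @^-1` `[x, +oo[%classic.
have mA r : measurable (A r).
  rewrite /A; case: ifP => _ //.
  by rewrite -[X in measurable X]setTI; exact: oppr_measurable.
have qA r : (q%:E <= normal_prob 0%R 1%R (A r))%E.
  by rewrite /A; case: ifP => _ //; rewrite normal_probN.
pose M (r : 'I_m) :=
  [set w | forall i : 'I_p, (i %/ n)%N = r -> ~ A r (Z i w)].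
have miss (r : 'I_m) := @block_miss_probability n r (A r) q GZ n0
  (leq_trans (leq_mul (ltn_ord r) (leqnn n)) mn) (mA r) q0 (qA r).
apply: (@probability_union2_le _ _ _ _ _ (\big[setU/set0]_r M r)
  [set w | c <= `|\sum_i Z i w|]).
- exact: measurable_posi_event.
- by apply: bigsetU_measurable => r _; exact: (miss r).1.
- exact: measurable_sum_event.
- move=> w /= Kw.
  have [[r Mr]|hit] := pselect (exists r, M r w).
    by left; apply: (mem_bigsetU (i := r)).
  right; rewrite leNgt; apply/negP => Sc.
  have /choice[f fP] : forall r : 'I_m,
      exists i : 'I_p, (i %/ n)%N = r /\ A r (Z i w).
    move=> r; apply: contrapT => no; apply: hit; exists r => i ir Ai.
    by apply: no; exists i.
  have f_inj : injective f.
    by move=> r s rs; apply: val_inj; rewrite /= -(fP r).1 rs (fP s).1.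
  pose r0 : 'I_m := Ordinal m0.
  have cardM : #|f @: [set: 'I_m]%SET| = m by rewrite card_imset// cardsT card_ord.
  have sumE : \sum_i (\row_i Z i w) 0 i = \sum_i Z i w.
    by apply: eq_bigr => i _; rewrite mxE.
  have := @posi_stat_ge R p x (\row_i Z i w) (f @: [set: 'I_m]%SET) (f r0) x0.
  rewrite cardM imset_f ?inE// sumE mxE => /(_ isT) main.
  have : 2 * x * ((m%:R - 1) / (m%:R + 1)) - `|\sum_i Z i w| / Num.sqrt p%:R <= K.
    apply: le_trans Kw; apply: main.
      by have := (fP r0).2; rewrite /A /= in_itv/= andbT.
    move=> k /imsetP[r _ ->] rr0; rewrite mxE.
    have := (fP r).2; rewrite /A; case: eqP => [r00|_]; last first.
      by rewrite /= in_itv/= andbT lerNr.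
    by move: rr0; rewrite (_ : r = r0) ?eqxx//; exact: val_inj.
  have : `|\sum_i Z i w| / Num.sqrt p%:R <= c / Num.sqrt p%:R.
    by rewrite ler_wpM2r ?invr_ge0 ?sqrtr_ge0// ltW.
  by lra.
- have := @probability_bigsetU_le _ _ _ P _ M (expR (- (n%:R * q)))
    (fun r => (miss r).1) (fun r => (miss r).2).
  by rewrite card_ord.
- exact: gaussian_sum_tail.
Qed.

End blocks.

(** * Asymptotics *)

Lemma expRN_le_inv (R : realType) (y : R) : 0 < y -> expR (- y) <= y^-1.
Proof.
move=> y0; rewrite expRN lef_pV2 ?posrE ?expR_gt0//.
by apply: le_trans (expR_ge1Dx y); rewrite lerDr.
Qed.

Lemma near_ln_ge (R : realType) (C : R) : \forall p \near \oo, C <= ln p%:R.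
Proof.
near=> p; have pC : expR C <= p%:R by near: p; exact: nbhs_infty_ger.
by rewrite -(expRK C) ler_ln// posrE ?expR_gt0// (lt_le_trans (expR_gt0 C)).
Unshelve. all: end_near. Qed.

(** With [s = sqrt (2 ln p)], the three error probabilities are [O (1 / ln p)]
    for fixed [e] and [m].  The inequality [exp (- y) <= 1 / y] is precise
    enough to see it. *)
Section budgets.
Context (R : realType) (p : nat) (e : R).
Hypotheses (e0 : 0 < e) (L0 : 0 < ln p%:R :> R).
Let L : R := ln p%:R.
Let s : R := Num.sqrt (2 * L).

Let p0 : 0 < p%:R :> R.
Proof. by rewrite ltNge; apply/negP => /ln0 h; have := L0; rewrite h ltxx. Qed.

Let s2 : s ^+ 2 = 2 * L.
Proof. by rewrite sqr_sqrtr// mulr_ge0// ltW. Qed.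

Let pE : p%:R = expR L.
Proof. by rewrite lnK// posrE. Qed.

Let s_gt0 : 0 < s.
Proof. by rewrite sqrtr_gt0 mulr_gt0. Qed.

Lemma sum_budget :
  4 * p%:R / (e * s * Num.sqrt p%:R) ^+ 2 = 2 / e ^+ 2 / L.
Proof.
rewrite !exprMn s2 sqr_sqrtr ?ltW//.
by field; rewrite !gt_eqF.
Qed.

(** [p exp (- (1 + e) ^ 2 ln p)] is at most [exp (- 2 e ln p)]. *)
Lemma max_budget :
  p%:R * (2 * expR (- (((1 + e) * s) ^+ 2 / 2))) <= e^-1 / L.
Proof.
have -> : ((1 + e) * s) ^+ 2 / 2 = (1 + e) ^+ 2 * L.
  by rewrite exprMn s2; field.
rewrite pE mulrCA -expRD.
apply: (@le_trans _ _ (2 * expR (- (2 * e * L)))).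
  rewrite ler_pM2l// ler_expR.
  by have := mulr_ge0 (sqr_ge0 e) (ltW L0); rewrite -/L; nra.
apply: le_trans (_ : 2 * (2 * e * L)^-1 <= _).
  by rewrite ler_pM2l// expRN_le_inv// !mulr_gt0.
rewrite le_eqVlt; apply/orP; left; apply/eqP; field.
by rewrite !gt_eqF.
Qed.

(** As soon as [e s >= 2], the threshold [(1 - e) s + 1] is at most
    [(1 - e / 2) s]; the expected number of hits in a block is then of order at
    least [p ^ (1 - (1 - e / 2) ^ 2)], hence at least of order [ln p]. *)
Lemma block_budget (m : nat) (c0 : R) : e <= 1 -> 0 < c0 -> (0 < m)%N ->
  (m <= p)%N -> 2 <= e * s ->
  m%:R * expR (- ((p %/ m)%N%:R
                  * (c0 * expR (- (((1 - e) * s + 1) ^+ 2 / 2)))))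
  <= 4 * m%:R ^+ 2 / (c0 * e) / L.
Proof.
move=> e1 c00 m0 mp es2.
have m0' : 0 < m%:R :> R by rewrite ltr0n.
set q := expR (- (_ ^+ 2 / 2)); set n : R := (p %/ m)%N%:R.
have np : p%:R / (2 * m%:R) <= n.
  rewrite ler_pdivrMr ?mulr_gt0// /n -!natrM ler_nat.
  rewrite mulnCA mul2n -addnn [X in (X <= _)%N](divn_eq p m) leq_add2l.
  by rewrite (leq_trans (ltnW (ltn_pmod p m0)))// leq_pmull// divn_gt0.
have qL : expR (- ((1 - e / 2) ^+ 2 * L)) <= q.
  rewrite /q ler_expR lerN2.
  have -> : (1 - e / 2) ^+ 2 * L = ((1 - e / 2) * s) ^+ 2 / 2.
    by rewrite exprMn s2; field.
  have s0 : 0 <= (1 - e) * s by rewrite mulr_ge0 ?subr_ge0// ltW.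
  have sle : (1 - e) * s + 1 <= (1 - e / 2) * s by lra.
  by rewrite ler_pM2r//; apply: lerXn2r; rewrite ?nnegrE//; lra.
have nq : c0 * e * L / (4 * m%:R) <= n * (c0 * q).
  apply: (@le_trans _ _ (p%:R / (2 * m%:R)
      * (c0 * expR (- ((1 - e / 2) ^+ 2 * L))))); last first.
    apply: ler_pM => //.
    - by rewrite mulr_ge0 ?expR_ge0// ltW.
    - by rewrite ler_pM2l.
  rewrite pE.
  have -> : expR L / (2 * m%:R) * (c0 * expR (- ((1 - e / 2) ^+ 2 * L))) =
      c0 / (2 * m%:R) * expR (L - (1 - e / 2) ^+ 2 * L).
    by rewrite expRD; field; rewrite gt_eqF.
  have -> : c0 * e * L / (4 * m%:R) = c0 / (2 * m%:R) * (e / 2 * L).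
    by field; rewrite gt_eqF.
  rewrite ler_pM2l ?divr_gt0 ?mulr_gt0//.
  apply: le_trans (expR_ge1Dx _).
  have ee : e ^+ 2 <= e by rewrite expr2 ler_piMr// ltW.
  have sqE : (1 - e / 2) ^+ 2 = 1 - e + e ^+ 2 / 4 by field.
  have half_le : e / 2 <= 1 - (1 - e / 2) ^+ 2.
    by rewrite sqE; have := e0; lra.
  have : e / 2 * L <= (1 - (1 - e / 2) ^+ 2) * L by rewrite ler_pM2r.
  by lra.
have A0 : 0 < c0 * e * L / (4 * m%:R) by rewrite divr_gt0 ?mulr_gt0.
apply: (@le_trans _ _ (m%:R * (c0 * e * L / (4 * m%:R))^-1)).
  rewrite ler_pM2l//; apply: le_trans (expRN_le_inv _) _.
    exact: lt_le_trans nq.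
  by rewrite lef_pV2 ?posrE// (lt_le_trans A0).
rewrite le_eqVlt; apply/orP; left; apply/eqP; field.
by rewrite !gt_eqF.
Qed.

End budgets.

Section exchangeable_posi_constant.
Context (R : realType) (d : nat -> measure_display)
  (T : forall p : nat, measurableType (d p)) (P : forall p : nat, probability (T p) R)
  (Z : forall p : nat, 'I_p -> {RV (P p) >-> R}).
Arguments Z : clear implicits.

(** Thresholds [x = (1 + e) s] for the maximum and [c = e s sqrt p] for the
    sum, where [s = sqrt (2 ln p)], so that [2 x + c / sqrt p = (2 + 3 e) s]. *)
Lemma posi_stat_upper_level (p : nat) (a e alpha : R) :
  std_gaussian (Z p) -> 0 < e -> 0 < alpha -> - p%:R^-1 < a ->
  0 < ln p%:R :> R -> (e^-1 + 2 / e ^+ 2) / alpha <= ln p%:R ->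
  (P p (~` [set w | (posi_stat (exchangeable_design p a) (\row_i Z p i w)
              <= (2 + 3 * e) * Num.sqrt (2 * ln p%:R))%R]) <= alpha%:E)%E.
Proof.
move=> GZ e0 al0 pa L0 Lbig.
have p0 : 0 < p%:R :> R.
  by rewrite ltNge; apply/negP => /ln0 h; move: L0; rewrite h ltxx.
have s0 : 0 < Num.sqrt (2 * ln p%:R) :> R by rewrite sqrtr_gt0 mulr_gt0.
have sp0 : 0 < Num.sqrt p%:R :> R by rewrite sqrtr_gt0.
set s := Num.sqrt (2 * _) in s0 *.
have x0 : 0 <= (1 + e) * s by rewrite mulr_ge0 ?addr_ge0// ltW.
have c0 : 0 < e * s * Num.sqrt p%:R by rewrite !mulr_gt0.
have := posi_stat_tail GZ pa x0 c0; rewrite mulfK ?gt_eqF//.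
have -> : 2 * ((1 + e) * s) + e * s = (2 + 3 * e) * s by ring.
move=> /le_trans; apply; rewrite lee_fin sum_budget//.
apply: (@le_trans _ _ (e^-1 / ln p%:R + 2 / e ^+ 2 / ln p%:R)).
  by rewrite lerD2r; exact: max_budget.
by rewrite -mulrDl ler_pdivrMr// -ler_pdivrMl// [leLHS]mulrC.
Qed.

Lemma near_posi_constant_le (e alpha : R) :
  (forall p, std_gaussian (Z p)) -> 0 < e -> 0 < alpha < 1 ->
  \forall p \near \oo, forall a, - p%:R^-1 < a ->
    posi_constant (Z p) (exchangeable_design p a) alpha
    <= (2 + 3 * e) * Num.sqrt (2 * ln p%:R).
Proof.
move=> GZ e0 /andP[al0 al1]; near=> p => a pa.
apply: posi_constant_le => //; apply: posi_stat_upper_level => //.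
  by apply: (@lt_le_trans _ _ 1) => //; near: p; exact: near_ln_ge.
by near: p; exact: near_ln_ge.
Unshelve. all: end_near. Qed.

(** With [m >= 2 / e] the ratio [(m - 1) / (m + 1)] is at least [1 - e], and the
    thresholds [(1 - e) s] and [e s sqrt p] give [2 (1 - e) ^ 2 s - e s], which
    is at least [(2 - 5 e) s]. *)
Lemma near_posi_constant_ge (e alpha : R) :
  (forall p, std_gaussian (Z p)) -> 0 < e -> e <= 1 -> 0 < alpha < 1 ->
  \forall p \near \oo,
    (2 - 5 * e) * Num.sqrt (2 * ln p%:R)
    <= posi_constant (Z p) (exchangeable_design p 1) alpha.
Proof.
move=> GZ e0 e1 /andP[al0 al1].
have [m m0 me] : exists2 m, (0 < m)%N & 2 / e <= m%:R.
  exists (Num.bound (2 / e)).+1 => //.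
  have e2 : 0 <= 2 / e by rewrite divr_ge0// ltW.
  by rewrite (le_trans (ltW (archi_boundP e2)))// ler_nat.
have k0 : 0 < normal_peak (1 : R) by rewrite normal_peak_gt0// oner_neq0.
set k := normal_peak _ in k0.
pose C := 4 * m%:R ^+ 2 / (k * e) + 2 / e ^+ 2.
near=> p.
have L0 : 0 < ln p%:R :> R.
  by apply: (@lt_le_trans _ _ 1) => //; near: p; exact: near_ln_ge.
have LC : C / ((1 - alpha) / 2) <= ln p%:R by near: p; exact: near_ln_ge.
have Le : 2 / e ^+ 2 <= ln p%:R by near: p; exact: near_ln_ge.
have Lu : (e^-1 + 2 / e ^+ 2) / alpha <= ln p%:R by near: p; exact: near_ln_ge.
have mp : (m <= p)%N by near: p; exact: nbhs_infty_ge.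
have p0 : 0 < p%:R :> R by rewrite ltr0n (leq_trans m0).
have s0 : 0 < Num.sqrt (2 * ln p%:R) :> R by rewrite sqrtr_gt0 mulr_gt0.
have es2 : 2 <= e * Num.sqrt (2 * ln p%:R).
  rewrite -ler_sqr ?nnegrE//; last by rewrite mulr_ge0// ltW.
  rewrite exprMn sqr_sqrtr; last by rewrite mulr_ge0// ltW.
  move: Le; rewrite ler_pdivrMr ?exprn_gt0//; lra.
have sp0 : 0 < Num.sqrt p%:R :> R by rewrite sqrtr_gt0.
have p1 : - p%:R^-1 < 1 :> R by rewrite (@le_lt_trans _ _ 0)// oppr_le0 invr_ge0.
apply: (posi_constant_ge (posi_stat_upper_level (GZ p) e0 al0 p1 L0 Lu)).
move=> K; set s := Num.sqrt (2 * _) in s0 es2 * => Ks.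
have x0 : 0 <= (1 - e) * s by rewrite mulr_ge0 ?subr_ge0// ltW.
have c0 : 0 < e * s * Num.sqrt p%:R by rewrite !mulr_gt0.
have m0' : 0 < m%:R :> R by rewrite ltr0n.
pose q := k * expR (- (((1 - e) * s + 1) ^+ 2 / 2)).
have q0 : 0 <= q by rewrite mulr_ge0 ?expR_ge0// ltW.
have n0 : (0 < p %/ m)%N by rewrite divn_gt0.
have mn : (m * (p %/ m) <= p)%N by rewrite mulnC leq_trunc_div.
have Kx : K < 2 * ((1 - e) * s) * ((m%:R - 1) / (m%:R + 1))
              - e * s * Num.sqrt p%:R / Num.sqrt p%:R.
  rewrite mulfK ?gt_eqF//; apply: lt_le_trans Ks _.
  have em : 1 - e <= (m%:R - 1) / (m%:R + 1).
    rewrite ler_pdivlMr ?addr_gt0//; move: me; rewrite ler_pdivrMr//; lra.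
  have : (1 - e) * s * (1 - e) <= (1 - e) * s * ((m%:R - 1) / (m%:R + 1)).
    by rewrite ler_wpM2l.
  have : 0 <= e ^+ 2 * s by rewrite mulr_ge0 ?sqr_ge0// ltW.
  by nra.
have := posi_stat_lower_tail (GZ p) m0 n0 mn x0 c0 q0 (normal_prob_ray_ge x0) Kx.
move=> /le_lt_trans; apply; rewrite lte_fin sum_budget//.
apply: (@le_lt_trans _ _ (C / ln p%:R)).
  rewrite /C [leRHS]mulrDl lerD2r; exact: block_budget.
apply: (@le_lt_trans _ _ ((1 - alpha) / 2)); last by lra.
have al' : 0 < (1 - alpha) / 2 by lra.
by move: LC; rewrite ler_pdivrMr// => LC; rewrite ler_pdivrMr// [leRHS]mulrC.
Unshelve. all: end_near. Qed.

End exchangeable_posi_constant.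
Unset Implicit Arguments.

Theorem theorem6p1 (R : realType)
    (d : nat -> measure_display) (T : forall p : nat, measurableType (d p))
    (P : forall p : nat, probability (T p) R)
    (Z : forall p : nat, 'I_p -> {RV (P p) >-> R})
    (hZ : forall p : nat, std_gaussian (Z p))
    (alpha : R) (halpha : 0 < alpha < 1) :
  (fun p : nat =>
     ereal_sup [set (posi_constant (Z p) (exchangeable_design p a) alpha
                       / Num.sqrt (2 * ln p%:R))%:E
               | a in [set a : R | - p%:R^-1 < a]]) @ \oo --> 2%:E.
Proof.
set f := fun p : nat => _.
have main (e : R) : 0 < e ->
    \forall p \near \oo, ((2 - e)%:E <= f p <= (2 + e)%:E)%E.
  move=> e0; pose h := Num.min (e / 5) 1.
  have h0 : 0 < h by rewrite lt_min divr_gt0//=.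
  have h1 : h <= 1 by rewrite ge_min lexx orbT.
  have he : h <= e / 5 by rewrite ge_min lexx.
  near=> p.
  have s0 : 0 < Num.sqrt (2 * ln p%:R) :> R.
    rewrite sqrtr_gt0 mulr_gt0//.
    by apply: (@lt_le_trans _ _ 1) => //; near: p; exact: near_ln_ge.
  apply/andP; split.
    apply: (@le_trans _ _ (posi_constant (Z p) (exchangeable_design p 1) alpha
                       / Num.sqrt (2 * ln p%:R))%:E).
      rewrite lee_fin ler_pdivlMr//.
      apply: (@le_trans _ _ ((2 - 5 * h) * Num.sqrt (2 * ln p%:R))).
        by rewrite ler_pM2r//; lra.
      by near: p; exact: near_posi_constant_ge.
    apply: ereal_sup_ubound; exists 1 => //=.
  apply: ge_ereal_sup => _ [a pa <-]; rewrite lee_fin ler_pdivrMr//.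
  apply: (@le_trans _ _ ((2 + 3 * h) * Num.sqrt (2 * ln p%:R))); last first.
    by rewrite ler_pM2r//; lra.
  by move: a pa; near: p; exact: near_posi_constant_le.
apply/fine_cvgP; split.
  have := main 1 ltr01; apply: filterS => p /andP[].
  by case: (f p) => //=; rewrite ?leeNy_eq ?leye_eq.
apply/cvgrPdist_le => e /main; apply: filterS => p /andP[] /=.
case: (f p) => [r| |]; rewrite ?leye_eq ?leeNy_eq//= !lee_fin => h1 h2.
by rewrite ler_distlC; lra.
Unshelve. all: end_near. Qed.
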